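(* Let $G$ be a graph on $n$ vertices with at least one edge and maximum degree $\Delta$, and let $v_1$ be a vertex of $G$ of degree $\Delta$. Let $m_1$ be the number of edges of $G$ with both ends in $N_G(v_1)$, let $m_2$ be the number of edges with both ends in $V(G)\setminus N_G[v_1]$, and let $m_3$ be the number of edges between $N_G(v_1)$ and $V(G)\setminus N_G[v_1]$. Then, for any $\alpha\in[0,1]$ with $\alpha\ne\frac12$, $$\lambda_1(B_\alpha(G))\ge\frac{Y}{Z},$$ where $$\begin{aligned}Y=&\Big[\alpha^2(3\alpha-1)^2(\Delta+1)^2\big(2\alpha m_2+(1-\alpha)m_3\big)+(1-\alpha)(2\alpha-1)^2(2\Delta+5\alpha-3\alpha^2)^2\Delta\Big]P^2\\&+4(2\alpha-1)^2(\Delta+1)\Big[(2\alpha-1)\Delta(2\Delta+5\alpha-3\alpha^2)+\alpha(3\alpha-1)(\Delta+1)m_3\Big]PQ\\&+4(2\alpha-1)^2(\Delta+1)^2\Big[2\alpha m_1+(1-\alpha)(\Delta+m_3)\Big]Q^2,\end{aligned}$$ $$Z=\Big[(2\alpha-1)^2(2\Delta+5\alpha-3\alpha^2)^2+\alpha^2(3\alpha-1)^2(\Delta+1)^2(n-\Delta-1)\Big]P^2+4\Delta(\Delta+1)^2(2\alpha-1)^2Q^2,$$ with $$P=(2\alpha-1)\Big((\alpha-1)(3\alpha-2)\Delta+2\Big),\qquad Q=16\alpha^2-6\alpha^3-10\alpha+2.$$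
   Context: All graphs are simple and undirected, with a finite vertex set. $A(G)$ is the adjacency matrix, $D(G)$ the diagonal matrix of vertex degrees, and $L(G)=D(G)-A(G)$ the Laplacian matrix of $G$. For $\alpha\in[0,1]$, $B_\alpha(G):=\alpha A(G)+(1-\alpha)L(G)$. $\lambda_1(S)$ denotes the largest eigenvalue of a real symmetric matrix $S$. $N_G(v_1)$ is the set of vertices adjacent to $v_1$, and $N_G[v_1]:=N_G(v_1)\cup\{v_1\}$. *)

(* Defs.v *)
From HB Require Import structures.
From mathcomp Require Import all_boot all_order all_algebra.
From mathcomp Require Import boolp classical_sets reals.

Set Implicit Arguments.
Unset Strict Implicit.
Unset Printing Implicit Defensive.

Import Order.TTheory GRing.Theory Num.Theory.
Local Open Scope ring_scope.

Record sgraph (V : finType) := SGraph {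
  adj :> rel V;
  adj_sym : symmetric adj;
  adj_irrefl : irreflexive adj }.

Section Graph.
Variables (V : finType) (G : sgraph V).

Definition edges : {set {set V}} := [set [set u; v] | u in V, v in V & G u v].

Definition nbhd (u : V) : {set V} := [set v | G u v].

Definition cnbhd (u : V) : {set V} := u |: nbhd u.

Definition deg (u : V) : nat := #|nbhd u|.

Definition maxdeg : nat := \max_(u : V) deg u.

Definition edges_in (X : {set V}) : {set {set V}} :=
  [set e in edges | e \subset X].

Definition edges_between (X Y : {set V}) : {set {set V}} :=
  [set e in edges | [exists u in X, exists v in Y, e == [set u; v]]].

End Graph.

(* Rows and columns are numbered by the enumeration [enum_val] of [V]; the
   spectrum does not depend on this choice. *)
Section Matrices.
Variables (R : realType) (V : finType) (G : sgraph V).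

Definition adj_mx : 'M[R]_#|V| :=
  \matrix_(i, j) (G (enum_val i) (enum_val j))%:R.

Definition deg_mx : 'M[R]_#|V| :=
  diag_mx (\row_i (deg G (enum_val i))%:R).

Definition lap_mx : 'M[R]_#|V| := deg_mx - adj_mx.

Definition B_mx (alpha : R) : 'M[R]_#|V| :=
  alpha *: adj_mx + (1 - alpha) *: lap_mx.

End Matrices.

(* The set of eigenvalues is finite, and it is nonempty when [S] is symmetric
   of positive size; the supremum is then a maximum. *)
Definition lambda1 (R : realType) (n : nat) (S : 'M[R]_n) : R :=
  sup [set a : R | eigenvalue S a]%classic.

(* Main.v *)
Require Import Defs.
From HB Require Import structures.
From mathcomp Require Import all_boot all_order all_algebra.
From mathcomp Require Import boolp classical_sets reals.
From mathcomp Require Import complex.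
From mathcomp Require Import ring lra.

Set Implicit Arguments.
Unset Strict Implicit.
Unset Printing Implicit Defensive.

Import Order.TTheory GRing.Theory Num.Theory.
Local Open Scope ring_scope.

(** The bound is a Rayleigh quotient.  For symmetric [S] every row vector [u]
    satisfies [u S u^T <= lambda_1(S) * u u^T] ([rayleigh_le_lambda1]).  The
    test vector takes three values: [a] at [v1], [b] on its neighbours and [c]
    on the remaining vertices.

    Summing over ordered pairs of adjacent vertices, the form [u B_alpha u^T]
    is the sum of [(2 alpha - 1) x_u x_v + (1 - alpha) x_u ^ 2]
    ([B_mx_quad]).  On the three blocks the summand is constant, so only the
    numbers of arcs between blocks matter: [Delta] between [v1] and its
    neighbours, none between [v1] and the far vertices, [2 m1] and [2 m2]
    inside the two large blocks and [m3] in each direction between them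
    ([stepfun_quad]).  With
      [a = (2 alpha - 1) (2 Delta + 5 alpha - 3 alpha ^ 2) P],
      [b = 2 (Delta + 1) (2 alpha - 1) Q],
      [c = alpha (3 alpha - 1) (Delta + 1) P],
    the form is exactly [Y] and the squared norm exactly [Z], which gives
    [Y <= lambda_1 Z].  If [Z = 0], the quotient is [0] by the convention on
    inverses, and the indicator vector of [v1], whose Rayleigh quotient is
    [(1 - alpha) Delta], shows that [lambda_1] is nonnegative.

    The Rayleigh inequality comes from unitary diagonalization over [R[i]]: in
    an eigenbasis both quadratic forms are weighted sums with the same
    nonnegative weights ([sym_spectral_weights]). *)

(** * The Rayleigh inequality for real symmetric matrices *)

(** The weights [w] are the squared moduli of the coordinates of [u] in a
    unitary eigenbasis of [S] over [R[i]].  They are real, and so are the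
    eigenvalues, so the spectral theorem can be used over [R] in this form
    with no further mention of complex numbers. *)
Lemma sym_spectral_weights (R : rcfType) (n : nat) (S : 'M[R]_n) :
  S^T = S ->
  exists2 s : 'I_n -> R, (forall i, eigenvalue S (s i)) &
    forall u : 'rV_n, exists w : 'I_n -> R,
      [/\ forall i, 0 <= w i,
          (u *m u^T) 0 0 = \sum_i w i &
          (u *m S *m u^T) 0 0 = \sum_i s i * w i].
Proof.
move=> symS; pose toC := real_complex R; pose A := map_mx toC S.
have conj_toC m (B : 'M[R]_(1, m)) :
    map_mx Num.conj (map_mx toC B) = map_mx toC B.
  by apply/matrixP=> i j; rewrite !mxE; apply: conjc_real.
have Aherm : A \is hermsymmx.
  apply: realsym_hermsym; last first.
    apply/mxOverP=> i j; rewrite mxE.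
    by apply/Creal_ImP; rewrite -complexIm.
  apply/is_hermitianmxP; rewrite expr0 scale1r map_mx_id //.
  by rewrite -[LHS]/(map_mx toC S) -{1}symS map_trmx.
have Aeq := orthomx_spectralP (hermitian_normalmx Aherm).
have /mxOverP sp_real := hermitian_spectral_diag_real Aherm.
set U := spectralmx A in Aeq; set d := spectral_diag A in Aeq sp_real.
have Uunit : U \in unitmx := spectral_unit A.
have Uinv : invmx U = map_mx Num.conj U^T.
  by rewrite invmx_unitary ?spectral_unitarymx // map_trmx.
have diagE : U *m A = diag_mx d *m U.
  by rewrite {1}Aeq !mulmxA mulmxV // mul1mx.
pose s i := complex.Re (d 0 i).
have dE i : d 0 i = toC (s i) by rewrite /toC /s RRe_real.
exists s => [i|u].
  rewrite -(eigenvalue_map toC); apply/eigenvalueP; exists (row i U).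
    by rewrite -row_mul diagE row_mul row_diag_mx -scalemxAl -rowE dE.
  apply: contraTneq isT => /(congr1 (mulmx^~ (invmx U))).
  rewrite rowE -mulmxA mulmxV // mulmx1 mul0mx => /matrixP/(_ 0 i).
  by rewrite !mxE !eqxx => /eqP; rewrite oner_eq0.
(* [y] holds the coordinates of [u] in the eigenbasis. *)
pose x := map_mx toC u; pose y := x *m invmx U.
have ystar : map_mx Num.conj y^T = U *m x^T.
  rewrite trmx_mul Uinv -map_trmx trmxK map_mxM -map_mx_comp -map_trmx conj_toC.
  by congr (_ *m _); apply/matrixP=> i j; rewrite !mxE /= conjCK.
have quad (e : 'rV_n) :
    (x *m (invmx U *m diag_mx e *m U) *m x^T) 0 0
      = \sum_i e 0 i * `|y 0 i| ^+ 2.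
  rewrite !mulmxA -/y -[_ *m U *m _]mulmxA -ystar !mxE; apply: eq_bigr => i _.
  by rewrite mul_mx_diag !mxE normCK mulrAC mulrC mulrA mulrAC.
have toC_quad (B : 'M_n) : toC ((u *m B *m u^T) 0 0)
    = (x *m map_mx toC B *m x^T) 0 0.
  by rewrite map_trmx -!map_mxM [RHS]mxE.
have norm_real i : `|y 0 i| ^+ 2 = toC (complex.Re (`|y 0 i| ^+ 2)).
  by rewrite /toC RRe_real // realX // normr_real.
exists (fun i => complex.Re (`|y 0 i| ^+ 2)); split.
- by move=> i; rewrite -(@ler0c R) -/(toC _) -norm_real exprn_ge0.
- apply: (@complexI R); rewrite -/toC -[X in X *m u^T]mulmx1 toC_quad map_mx1.
  have -> : 1%:M = invmx U *m diag_mx (const_mx 1) *m U.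
    by rewrite diag_const_mx mulmx1 mulVmx.
  rewrite quad /toC rmorph_sum; apply: eq_bigr => i _.
  by rewrite mxE mul1r norm_real.
- apply: (@complexI R); rewrite -/toC toC_quad -/A Aeq quad /toC rmorph_sum.
  by apply: eq_bigr => i _; rewrite dE rmorphM [in LHS]norm_real.
Qed.

(** Each eigenvalue is at most [lambda_1], so the weights of [u] give the
    inequality by comparing the two sums termwise.  Since [lambda_1] is a
    supremum, the eigenvalues must also be shown to be bounded: the weights of
    an eigenvector exhibit its eigenvalue as a weighted mean of the [s i]. *)
Lemma rayleigh_le_lambda1 (R : realType) (n : nat) (S : 'M[R]_n) (u : 'rV_n) :
  S^T = S -> (u *m S *m u^T) 0 0 <= lambda1 S * (u *m u^T) 0 0.
Proof.
move=> symS; have [s eig_s weights] := sym_spectral_weights symS.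
have le_sum i : s i <= \sum_j `|s j|.
  rewrite (bigD1 i) //= (le_trans (ler_norm _)) // lerDl.
  by apply: sumr_ge0 => j _; apply: normr_ge0.
have ubS : has_ubound [set a : R | eigenvalue S a]%classic.
  exists (\sum_j `|s j|) => a /= /eigenvalueP[v vS v_neq0].
  have [w [w_ge0 vv vSv]] := weights v.
  move: vSv; rewrite vS -scalemxAl mxE vv => vSv.
  have w_gt0 : 0 < \sum_i w i.
    rewrite lt_neqAle sumr_ge0 // andbT eq_sym -vv.
    apply: contraNneq v_neq0 => vv0; apply/eqP/rowP=> i.
    move/eqP: vv0; rewrite !mxE psumr_eq0 => [/allP/(_ i)|j _].
      by rewrite mem_index_enum mxE mulf_eq0 orbb => /(_ isT)/eqP.
    by rewrite mxE -expr2 sqr_ge0.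
  rewrite -(ler_pM2r w_gt0) vSv mulr_sumr; apply: ler_sum => i _.
  exact: ler_wpM2r.
have [w [w_ge0 -> ->]] := weights u.
rewrite mulr_sumr; apply: ler_sum => i _; apply: ler_wpM2r => //.
by apply: ub_le_sup => //; apply: eig_s.
Qed.

(** * Counting arcs between vertex sets *)

Section ArcCount.
Variables (V : finType) (G : sgraph V).
Implicit Types (X Y : {set V}) (u v : V).

(** Ordered adjacent pairs are counted because the sums over [V * V] in the
    quadratic forms produce them. *)
Definition arcs X Y : nat := \sum_(u in X) \sum_(v in Y) G u v.

Lemma arcsC X Y : arcs X Y = arcs Y X.
Proof.
rewrite /arcs exchange_big; apply: eq_bigr => v _; apply: eq_bigr => u _.
by rewrite adj_sym.
Qed.

Lemma arcs1 v : arcs [set v] [set v] = 0%N.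
Proof. by rewrite /arcs !big_set1 adj_irrefl. Qed.

Lemma arcs1_nbhd v : arcs [set v] (nbhd G v) = deg G v.
Proof.
rewrite /arcs big_set1 /deg -sum1_card; apply: eq_bigr => u.
by rewrite inE => ->.
Qed.

Lemma arcs1_far v : arcs [set v] (~: cnbhd G v) = 0%N.
Proof.
rewrite /arcs big_set1 big1 // => u.
by rewrite !inE negb_or => /andP[_ /negbTE->].
Qed.

(** Double counting along [(u, v) |-> [set u; v]]: the common scheme of
    [arcs_within], where an edge carries both its orientations, and of
    [arcs_across], where only one orientation starts in [X]. *)
Lemma arcs_fiber X Y (E : {set {set V}}) k :
    {in X & Y, forall u v, G u v -> [set u; v] \in E} ->
    {in E, forall e, #|[set p | [&& p.1 \in X, p.2 \in Y, G p.1 p.2 &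
       [set p.1; p.2] == e]]| = k} ->
  arcs X Y = (#|E| * k)%N.
Proof.
move=> toE fiberk; rewrite /arcs pair_big /=.
rewrite (bigID (fun p : V * V => G p.1 p.2)) /= [X in (_ + X)%N]big1 ?addn0.
  rewrite (partition_big (fun p => [set p.1; p.2]) (mem E)) /=; last first.
    by move=> p /andP[/andP[pX pY] Gp]; apply: toE.
  rewrite -sum_nat_const; apply: eq_bigr => e /fiberk <-.
  rewrite -sum1_card; apply: eq_big => [p|p /andP[/andP[_ ->]] //].
  by rewrite inE !andbA.
by move=> p /andP[_ /negbTE->].
Qed.

Lemma set2_inj u v x y : [set u; v] = [set x; y] ->
  (u, v) = (x, y) \/ (u, v) = (y, x).
Proof.
move=> eq_uv.
have: x \in [set u; v] by rewrite eq_uv set21.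
have: y \in [set u; v] by rewrite eq_uv set22.
have: u \in [set x; y] by rewrite -eq_uv set21.
have: v \in [set x; y] by rewrite -eq_uv set22.
by rewrite !inE; do 4![case/orP=> /eqP ?]; subst; auto.
Qed.

Lemma arcs_within X : arcs X X = (#|edges_in G X| * 2)%N.
Proof.
apply: arcs_fiber => [u v uX vX Guv|e].
  rewrite inE; apply/andP; split.
    by apply/imset2P; exists u v; rewrite ?inE.
  by rewrite finset.subUset !finset.sub1set uX.
rewrite inE => /andP[/imset2P[u v _]]; rewrite inE => /andP[_ Guv] ->.
rewrite finset.subUset !finset.sub1set => /andP[uX vX].
have neq_uv : (u, v) != (v, u).
  by apply: contraTneq Guv => -[-> _]; rewrite adj_irrefl.
have <- : #|[set (u, v); (v, u)]| = 2%N by rewrite cards2 neq_uv.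
apply: eq_card => -[x y]; rewrite !inE /=; apply/and4P/orP.
  by case=> _ _ _ /eqP/set2_inj[->|->]; [left|right].
case=> /eqP[-> ->]; rewrite ?[G v u]adj_sym; split=> //.
by rewrite finset.setUC.
Qed.

Lemma arcs_across X Y : [disjoint X & Y] -> arcs X Y = #|edges_between G X Y|.
Proof.
move=> disXY; rewrite -[RHS]muln1; apply: arcs_fiber => [u v uX vY Guv|e].
  rewrite inE; apply/andP; split.
    by apply/imset2P; exists u v; rewrite ?inE.
  by apply/existsP; exists u; rewrite uX; apply/existsP; exists v; rewrite vY /=.
rewrite inE => /andP[/imset2P[x y _]]; rewrite inE => /andP[_ Gxy] -> {e}.
case/exists_inP=> u uX /exists_inP[v vY /eqP eq_uv].
have Guv : G u v.
  by case: (set2_inj (esym eq_uv)) => -[-> ->] //; rewrite adj_sym.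
rewrite eq_uv; apply/eqP/cards1P; exists (u, v).
apply/setP=> -[x' y']; rewrite !inE /=; apply/and4P/eqP.
  case=> x'X _ _ /eqP/set2_inj[//|[eq_x' _]].
  by move: (disjointFr disXY x'X); rewrite eq_x' vY.
by case=> -> ->.
Qed.

End ArcCount.

(** * The quadratic form on vectors with three values *)

Section QuadraticForm.
Variables (R : realType) (V : finType) (G : sgraph V).

Definition fun_row (x : V -> R) : 'rV[R]_#|V| := \row_i x (enum_val i).

Lemma sum_enum_val (F : V -> R) :
  \sum_(i < #|V|) F (enum_val i) = \sum_v F v.
Proof. by rewrite -(big_enum_val (A := V)). Qed.

Lemma B_mx_sym (alpha : R) : (B_mx G alpha)^T = B_mx G alpha.
Proof.
apply/matrixP=> i j; rewrite !mxE [G (enum_val j) _]adj_sym.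
by rewrite [j == i]eq_sym; case: eqP => [->|].
Qed.

Lemma fun_row_norm (x : V -> R) :
  (fun_row x *m (fun_row x)^T) 0 0 = \sum_v x v ^+ 2.
Proof. by rewrite -sum_enum_val mxE; apply: eq_bigr => i _; rewrite !mxE. Qed.

(** [B_alpha = (2 alpha - 1) A + (1 - alpha) D], and the degree of [u] is
    itself a sum over the arcs that leave [u]; so the diagonal part turns into
    the terms [x u ^+ 2] of the same arc sum. *)
Lemma B_mx_quad (alpha : R) (x : V -> R) :
  (fun_row x *m B_mx G alpha *m (fun_row x)^T) 0 0 =
  \sum_u \sum_v
    (G u v)%:R * ((2 * alpha - 1) * x u * x v + (1 - alpha) * x u ^+ 2).
Proof.
have degE u : (deg G u)%:R = \sum_v (G u v)%:R :> R.
  rewrite /deg -sum1_card natr_sum [RHS](bigID (mem (nbhd G u))) /=.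
  rewrite [X in _ + X]big1 ?addr0 => [|v]; last by rewrite inE => /negbTE->.
  by apply: eq_bigr => v; rewrite inE => ->.
rewrite mxE -[RHS]sum_enum_val.
under eq_bigr => j _ do rewrite mxE mulr_suml.
rewrite exchange_big; apply: eq_bigr => i _ /=.
under [RHS]eq_bigr => v _ do rewrite mulrDr.
rewrite big_split /= -mulr_suml -degE.
under eq_bigr => j _.
  have -> : fun_row x 0 i * B_mx G alpha i j * (fun_row x)^T j 0
      = (G (enum_val i) (enum_val j))%:R
          * ((2 * alpha - 1) * x (enum_val i) * x (enum_val j))
        + (1 - alpha) * x (enum_val i) * x (enum_val j)
          * ((deg G (enum_val i))%:R *+ (i == j)).
    by rewrite !mxE; ring.
  over.
rewrite big_split /= -[in RHS]sum_enum_val; congr (_ + _).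
rewrite (bigD1 i) //= big1 ?addr0 => [|j /negbTE]; last first.
  by rewrite eq_sym => ->; rewrite mulr0n mulr0.
by rewrite eqxx mulr1n; ring.
Qed.

Lemma sum_around (v1 : V) (F : V -> R) :
  \sum_v F v = \sum_(v in [set v1]) F v + \sum_(v in nbhd G v1) F v
               + \sum_(v in ~: cnbhd G v1) F v.
Proof.
rewrite big_set1 (bigD1 v1) //= -addrA; congr (_ + _).
rewrite (bigID (mem (nbhd G v1))) /=; congr (_ + _); apply: eq_bigl => v.
  rewrite inE; case: eqP => //= ->; by rewrite adj_irrefl.
by rewrite !inE negb_or.
Qed.

Lemma sum_arcs (X Y : {set V}) (F : V -> V -> R) c :
    {in X & Y, forall u v, F u v = c} ->
  \sum_(u in X) \sum_(v in Y) (G u v)%:R * F u v = (arcs G X Y)%:R * c.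
Proof.
move=> Fc; rewrite /arcs natr_sum mulr_suml; apply: eq_bigr => u uX.
rewrite natr_sum mulr_suml; apply: eq_bigr => v vY.
by rewrite Fc.
Qed.

Definition stepfun (v1 : V) (a b c : R) (v : V) : R :=
  if v == v1 then a else if G v1 v then b else c.

Lemma stepfun_v1 v1 a b c : {in [set v1], forall v, stepfun v1 a b c v = a}.
Proof. by move=> v /set1P->; rewrite /stepfun eqxx. Qed.

Lemma stepfun_nbhd v1 a b c : {in nbhd G v1, forall v, stepfun v1 a b c v = b}.
Proof.
move=> v; rewrite inE /stepfun; case: eqP => [->|_ ->//].
by rewrite adj_irrefl.
Qed.

Lemma stepfun_far v1 a b c :
  {in ~: cnbhd G v1, forall v, stepfun v1 a b c v = c}.
Proof.
by move=> v; rewrite !inE negb_or /stepfun => /andP[/negbTE-> /negbTE->].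
Qed.

Lemma stepfun_norm v1 (a b c : R) :
  \sum_v stepfun v1 a b c v ^+ 2 =
    a ^+ 2 + (deg G v1)%:R * b ^+ 2
    + (#|V|%:R - (deg G v1)%:R - 1) * c ^+ 2.
Proof.
have card_far : #|V|%:R - (deg G v1)%:R - 1 = #|~: cnbhd G v1|%:R :> R.
  rewrite -(cardsC (cnbhd G v1)) cardsU1 inE adj_irrefl natrD natrD /=.
  by rewrite /deg; ring.
rewrite (sum_around v1) card_far !mulr_natl -!sumr_const.
congr (_ + _ + _).
- by rewrite big_set1 (stepfun_v1 _ _ _ (set11 v1)).
- by apply: eq_bigr => v /stepfun_nbhd->.
- by apply: eq_bigr => v /stepfun_far->.
Qed.

Lemma stepfun_quad (alpha : R) v1 (a b c : R) :
  let Delta : R := (deg G v1)%:R in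
  let m1 : R := #|edges_in G (nbhd G v1)|%:R in
  let m2 : R := #|edges_in G (~: cnbhd G v1)|%:R in
  let m3 : R := #|edges_between G (nbhd G v1) (~: cnbhd G v1)|%:R in
  let x := fun_row (stepfun v1 a b c) in
  (x *m B_mx G alpha *m x^T) 0 0 =
    (1 - alpha) * Delta * a ^+ 2 + 2 * (2 * alpha - 1) * Delta * a * b
    + (2 * alpha * m1 + (1 - alpha) * (Delta + m3)) * b ^+ 2
    + 2 * (2 * alpha - 1) * m3 * b * c
    + (2 * alpha * m2 + (1 - alpha) * m3) * c ^+ 2.
Proof.
move=> Delta m1 m2 m3 x; rewrite B_mx_quad.
set F := fun s t : R => (2 * alpha - 1) * s * t + (1 - alpha) * s ^+ 2.
have block (X Y : {set V}) s t :
    {in X, forall u, stepfun v1 a b c u = s} ->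
    {in Y, forall v, stepfun v1 a b c v = t} ->
  \sum_(u in X) \sum_(v in Y)
     (G u v)%:R * F (stepfun v1 a b c u) (stepfun v1 a b c v)
    = (arcs G X Y)%:R * F s t.
  by move=> Xs Yt; apply: sum_arcs => u v /Xs-> /Yt->.
have at1 := @stepfun_v1 v1 a b c.
have atN := @stepfun_nbhd v1 a b c; have atM := @stepfun_far v1 a b c.
under eq_bigr => u _ do rewrite (sum_around v1).
rewrite (sum_around v1) !big_split /=.
rewrite (block _ _ _ _ at1 at1) (block _ _ _ _ at1 atN) (block _ _ _ _ at1 atM).
rewrite (block _ _ _ _ atN at1) (block _ _ _ _ atN atN) (block _ _ _ _ atN atM).
rewrite (block _ _ _ _ atM at1) (block _ _ _ _ atM atN) (block _ _ _ _ atM atM).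
have disNM : [disjoint nbhd G v1 & ~: cnbhd G v1].
  by rewrite -setI_eq0; apply/eqP/setP=> v; rewrite !inE negb_or; case: (G v1 v);
     rewrite ?andbF.
rewrite arcs1 arcs1_nbhd arcs1_far [arcs G (nbhd _ _) [set _]]arcsC arcs1_nbhd.
rewrite arcs_within (arcs_across G disNM) [arcs G _ [set _]]arcsC arcs1_far.
rewrite [arcs G _ (nbhd _ _)]arcsC (arcs_across G disNM) arcs_within /F.
rewrite -/Delta -/m3 !natrM -/m1 -/m2; ring.
Qed.

End QuadraticForm.

Theorem theorem4p3 (R : realType) (V : finType) (G : sgraph V) (v1 : V)
    (alpha : R)
    (has_edge : (0 < #|edges G|)%N)
    (deg_v1 : deg G v1 = maxdeg G)
    (alpha_ge0 : 0 <= alpha) (alpha_le1 : alpha <= 1)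
    (alpha_neq : alpha <> 1 / 2) :
  let n : R := #|V|%:R in
  let Delta : R := (maxdeg G)%:R in
  let m1 : R := #|edges_in G (nbhd G v1)|%:R in
  let m2 : R := #|edges_in G (~: cnbhd G v1)|%:R in
  let m3 : R := #|edges_between G (nbhd G v1) (~: cnbhd G v1)|%:R in
  let P : R :=
    (2 * alpha - 1) * ((alpha - 1) * (3 * alpha - 2) * Delta + 2) in
  let Q : R := 16 * alpha ^+ 2 - 6 * alpha ^+ 3 - 10 * alpha + 2 in
  let Y : R :=
    (alpha ^+ 2 * (3 * alpha - 1) ^+ 2 * (Delta + 1) ^+ 2
       * (2 * alpha * m2 + (1 - alpha) * m3)
     + (1 - alpha) * (2 * alpha - 1) ^+ 2
       * (2 * Delta + 5 * alpha - 3 * alpha ^+ 2) ^+ 2 * Delta) * P ^+ 2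
    + 4 * (2 * alpha - 1) ^+ 2 * (Delta + 1)
      * ((2 * alpha - 1) * Delta * (2 * Delta + 5 * alpha - 3 * alpha ^+ 2)
         + alpha * (3 * alpha - 1) * (Delta + 1) * m3) * P * Q
    + 4 * (2 * alpha - 1) ^+ 2 * (Delta + 1) ^+ 2
      * (2 * alpha * m1 + (1 - alpha) * (Delta + m3)) * Q ^+ 2 in
  let Z : R :=
    ((2 * alpha - 1) ^+ 2 * (2 * Delta + 5 * alpha - 3 * alpha ^+ 2) ^+ 2
     + alpha ^+ 2 * (3 * alpha - 1) ^+ 2 * (Delta + 1) ^+ 2
       * (n - Delta - 1)) * P ^+ 2
    + 4 * Delta * (Delta + 1) ^+ 2 * (2 * alpha - 1) ^+ 2 * Q ^+ 2 in
  lambda1 (B_mx G alpha) >= Y / Z.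
Proof.
cbv zeta; set n : R := #|V|%:R; set Delta : R := (maxdeg G)%:R.
set m1 : R := #|edges_in G (nbhd G v1)|%:R.
set m2 : R := #|edges_in G (~: cnbhd G v1)|%:R.
set m3 : R := #|edges_between G _ _|%:R.
set P : R := (2 * alpha - 1) * (_ * Delta + 2).
set Q : R := 16 * alpha ^+ 2 - 6 * alpha ^+ 3 - 10 * alpha + 2.
set Y := (X in X / _); set Z := (X in _ / X).
have DeltaE : (deg G v1)%:R = Delta by rewrite deg_v1.
have rayleigh a b c : _ <= _ :=
  rayleigh_le_lambda1 (fun_row (stepfun G v1 a b c)) (B_mx_sym G alpha).
(* The three values are the square roots of the coefficients in [Z] of the
   block sizes [1], [Delta] and [n - Delta - 1]; the signs are those that give
   the mixed terms of [Y]. *)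
pose a := (2 * alpha - 1) * (2 * Delta + 5 * alpha - 3 * alpha ^+ 2) * P.
pose b := 2 * (Delta + 1) * (2 * alpha - 1) * Q.
pose c := alpha * (3 * alpha - 1) * (Delta + 1) * P.
have normE : \sum_v stepfun G v1 a b c v ^+ 2 = Z.
  by rewrite stepfun_norm DeltaE /Z /a /b /c -/n; ring.
have Z_ge0 : 0 <= Z by rewrite -normE sumr_ge0 // => v _; apply: sqr_ge0.
have [Z0|Z_neq0] := eqVneq Z 0.
  rewrite Z0 invr0 mulr0.
  have := rayleigh 1 0 0.
  rewrite fun_row_norm stepfun_norm stepfun_quad /= DeltaE => le_lambda1.
  have : 0 <= (1 - alpha) * Delta by rewrite mulr_ge0 ?subr_ge0 // ler0n.
  by lra.
rewrite ler_pdivrMr ?lt_neqAle ?Z_ge0 ?[0 == _]eq_sym ?Z_neq0 //.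
have := rayleigh a b c; rewrite fun_row_norm normE; apply: le_trans.
rewrite stepfun_quad /= DeltaE -/m1 -/m2 -/m3 le_eqVlt; apply/orP; left.
by apply/eqP; rewrite /Y /a /b /c; ring.
Qed.
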